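(* Let $f\in C[0,1]$, $x\in[0,1]$, and let $j,n$ be integers with $1\le j\le n$. Then: (a) for $n\ge 5$, $$|B_{n,0,2}(f;x)-f(x)|\le \frac{1}{\sqrt{n-1}}\,d_n(x)\,\omega_1\left(f;\frac{1}{\sqrt{n-1}}\right)+\bigl(1+x\,d_n(x)\bigr)\,\omega_2\left(f;\frac{1}{\sqrt{n-1}}\right),$$ where $d_n(x):=(1-x)\left[1-(1-x)^{n-1}\right]$; (b) for $n\ge 4$, $$|B_{n,0,j}(f;x)-f(x)|\le (j-1)\frac{1}{\sqrt n}\,\omega_1\left(f;\frac{1}{\sqrt n}\right)+\left(\frac18+j\right)\omega_2\left(f;\frac{1}{\sqrt n}\right).$$
   Context: $C[0,1]$ is the space of real-valued continuous functions on $[0,1]$. For integers $n\ge j\ge 1$, the operator $B_{n,0,j}$ of Aldaz, Kounchev and Render is defined for $f\in C[0,1]$, $x\in[0,1]$ by $$B_{n,0,j}(f;x)=\sum_{k=0}^n f\left(t_{n,k}^j\right)p_{n,k}(x),\qquad p_{n,k}(x)=\binom{n}{k}x^k(1-x)^{n-k},$$ $$t_{n,k}^j=\left(\frac{k(k-1)\cdots(k-j+1)}{n(n-1)\cdots(n-j+1)}\right)^{1/j}.$$ For $j=1$ this is the classical Bernstein operator; $B_{n,0,2}$ is the case $j=2$. The classical moduli of continuity of first and second order are, for $\delta\ge 0$, $$\omega_1(f;\delta)=\sup\{|f(u)-f(v)|: u,v\in[0,1],\ |u-v|\le\delta\},$$ $$\omega_2(f;\delta)=\sup\{|f(u+h)-2f(u)+f(u-h)|: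 0\le h\le\delta,\ u-h,\,u+h\in[0,1]\}.$$ *)

(* Defs.v *)
From HB Require Import structures.
From mathcomp Require Import all_boot all_order all_algebra.
From mathcomp Require Import all_classical all_reals all_analysis.

Set Implicit Arguments.
Unset Strict Implicit.
Unset Printing Implicit Defensive.

Import Order.TTheory GRing.Theory Num.Theory.
Import numFieldNormedType.Exports.

Local Open Scope classical_set_scope.
Local Open Scope ring_scope.

(* Functions on [0, 1] are represented by functions R -> R; every definition
   below only evaluates them at points of [0, 1]. *)

Definition omega1 (R : realType) (f : R -> R) (delta : R) : R :=
  sup [set r | exists u v : R,
    [/\ 0 <= u <= 1, 0 <= v <= 1, `|u - v| <= delta & r = `|f u - f v| ] ].

Definition omega2 (R : realType) (f : R -> R) (delta : R) : R :=
  sup [set r | exists u h : R,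
    [/\ 0 <= h <= delta, 0 <= u - h <= 1, 0 <= u + h <= 1
      & r = `|f (u + h) - 2 * f u + f (u - h)| ] ].

Definition bernstein_basis (R : realType) (n k : nat) (x : R) : R :=
  'C(n, k)%:R * x ^+ k * (1 - x) ^+ (n - k).

(* k ^_ j = k (k - 1) ... (k - j + 1), which is 0 when k < j; for j > 0,
   0 `^ j%:R^-1 = 0, so that the node is 0 in that case. *)
Definition akr_node (R : realType) (n j k : nat) : R :=
  ((k ^_ j)%:R / (n ^_ j)%:R) `^ (j%:R)^-1.

Definition akr_operator (R : realType) (n j : nat) (f : R -> R) (x : R) : R :=
  \sum_(0 <= k < n.+1) f (akr_node R n j k) * bernstein_basis n k x.

Definition dn (R : realType) (n : nat) (x : R) : R :=
  (1 - x) * (1 - (1 - x) ^+ (n - 1)).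

(* Main.v *)
Require Import Defs.
From HB Require Import structures.
From mathcomp Require Import all_boot all_order all_algebra.
From mathcomp Require Import all_classical all_reals all_analysis.
From mathcomp Require Import ring lra.
Import Order.TTheory GRing.Theory Num.Theory.
Import numFieldNormedType.Exports.
Local Open Scope classical_set_scope.
Local Open Scope ring_scope.

(* A positive linear functional F with F(1) = 1 satisfies Paltanea's estimate
   |F f - f x| <= |F(e1 - x)| / h * omega1 f h
                  + (1 + F((e1 - x)^2) / (2 h^2)) * omega2 f h, 0 < h <= 1/2.
   Subtract from f its chord on [y, z] and W2 (t - y) (z - t) / (2 h^2), where
   W2 = omega2 f h: the second differences of step h become nonnegative, so the
   maximum propagates by steps of -h until it is within h of an endpoint, where
   one second difference bounds it by W2.  By convex duality this control of
   the chords gives a slope s, |s| <= omega1 f h / h, with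
   f t - f x <= s (t - x) + (1 + (t - x)^2 / (2 h^2)) W2 on [0, 1]; apply F,
   and do the same for - f.
   For the operators, with p_k the Bernstein basis, everything reduces to
   bounds on the sum of (k/n - t_k) p_k.  For all k, k/n - t_k lies between 0
   and (j - 1) / n.  For j = 2 and k > 0, it is at most (1 - k/n) / (n - 1),
   because (k/n)^2 - t_k^2 = (k/n) (1 - k/n) / (n - 1). *)

(** * Second differences and the distance from a function to its chords *)

Lemma second_difference_max_principle (R : realType) (phi : R -> R)
    (y z h W : R) :
  y <= z -> 0 < h -> {within `[y, z], continuous phi} ->
  phi y <= 0 -> phi z <= 0 ->
  (forall t s : R, 0 <= s <= h -> y <= t - s -> t + s <= z ->
    - W <= phi (t + s) - 2 * phi t + phi (t - s)) ->
  (forall t : R, y <= t - h -> t + h <= z ->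
    0 <= phi (t + h) - 2 * phi t + phi (t - h)) ->
  forall t : R, y <= t <= z -> phi t <= W.
Proof.
move=> yz h0 cphi phiy phiz Hs Hh.
have [c cyz maxc] := EVT_max yz cphi.
have {}maxc t : y <= t -> t <= z -> phi t <= phi c.
  by move=> yt tz; apply: maxc; rewrite in_itv /= yt tz.
move: cyz; rewrite in_itv /= => /andP[yc cz].
suff phicW : phi c <= W.
  by move=> t /andP[yt tz]; apply: le_trans phicW; exact: maxc.
(* Take the second difference about t that reaches y: [phi y <= 0] and the value at the mirror point
   is at most [phi c], so [- W <= phi c - 2 * phi c]. *)
have near_left t : y <= t -> t - y <= h -> t + (t - y) <= z ->
    phi t = phi c -> phi c <= W.
  move=> yt th tz phit.
  have : - W <= phi (t + (t - y)) - 2 * phi t + phi (t - (t - y)).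
    by apply: Hs; lra.
  have := maxc (t + (t - y)).
  have -> : t - (t - y) = y by ring.
  lra.
(* Here m bounds the number of steps of length h from t down to y. At a maximum, a nonnegative
   second difference forces both neighbours to be maxima too. *)
have step_left m : forall t : R, y <= t -> t + h <= z -> phi t = phi c ->
    t - y <= m%:R * h -> phi c <= W.
  elim: m => [|m IHm] t yt thz phit tm.
    by apply: (near_left t) => //; lra.
  have [th|th] := leP (t - y) h; first by apply: (near_left t) => //; lra.
  apply: (IHm (t - h)); [lra|lra| |by move: tm; rewrite -natr1; lra].
  have := Hh t; have := maxc (t + h); have := maxc (t - h).
  by move=> m1 m2 m3; apply/eqP; rewrite eq_le; apply/andP; split; lra.
have [zc|zc] := leP (z - c) h; last first.
  apply: (step_left (Num.truncn ((c - y) / h)).+1 c) => //; first by lra.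
  rewrite -ler_pdivrMr //; apply: ltW; exact: truncnS_gt.
(* Now c is within h of z: use the nearer endpoint, so that the mirror point stays in the
   interval. *)
have [zcy|zcy] := leP (z - c) (c - y).
  have := Hs c (z - c); have := maxc (c - (z - c)).
  have -> : c + (z - c) = z by ring.
  move=> m1 m2; have {}m2 : - W <= phi z - 2 * phi c + phi (c - (z - c)).
    by apply: m2; [apply/andP; split; lra | lra|].
  lra.
by apply: (near_left c) => //; lra.
Qed.

(** Subtracting the chord leaves second differences unchanged, and subtracting the parabola
    [q * ((t - y) * (z - t))] adds [2 * q * s ^+ 2] to those of step s. The condition on q is only
    imposed when a second difference of step h fits into the interval, so short intervals allow q =
    0. *)
Lemma chord_gap_le (R : realType) (f : R -> R) (y z h q W t : R) :
  y < z -> 0 < h -> 0 <= q -> {within `[y, z], continuous f} ->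
  (forall t s : R, 0 <= s <= h -> y <= t - s -> t + s <= z ->
    - W <= f (t + s) - 2 * f t + f (t - s)) ->
  (2 * h <= z - y -> W <= 2 * q * h ^+ 2) ->
  y <= t <= z ->
  f t <= ((z - t) * f y + (t - y) * f z) / (z - y)
         + q * ((t - y) * (z - t)) + W.
Proof.
move=> yz h0 q0 cf Hs Hh tyz.
pose p (t : R) := ((z - t) * f y + (t - y) * f z) / (z - y)
                  + q * ((t - y) * (z - t)).
have zy0 : z - y != 0 by rewrite subr_eq0 gt_eqF.
have D2 u s : (f \- p) (u + s) - 2 * (f \- p) u + (f \- p) (u - s) =
    f (u + s) - 2 * f u + f (u - s) + 2 * q * s ^+ 2.
  by rewrite /p /=; field.
suff : (f \- p) t <= W by rewrite /p /=; lra.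
apply: (@second_difference_max_principle R (f \- p) y z h W) => //.
- exact: ltW.
- apply: within_continuousB => //; apply: continuous_subspaceT => u.
  have cid : (id : R -> R) @ u --> u by exact: cvg_id.
  have cc (k : R) : (fun=> k) @ u --> k by exact: cvg_cst.
  apply: cvgD.
    apply: cvgM; last exact: cc.
    by apply: cvgD; (apply: cvgM; [apply: cvgB | exact: cc]).
  by apply: cvgM; [exact: cc | apply: cvgM; apply: cvgB].
- by rewrite le_eqVlt; apply/orP; left; apply/eqP; rewrite /p /=; field.
- by rewrite le_eqVlt; apply/orP; left; apply/eqP; rewrite /p /=; field.
- move=> u s sh yu uz; rewrite D2.
  have := Hs u s sh yu uz.
  have : 0 <= 2 * q * s ^+ 2 by rewrite mulr_ge0 ?sqr_ge0 ?mulr_ge0.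
  lra.
- move=> u yu uz; rewrite D2.
  have := Hs u h; rewrite lexx (ltW h0) => /(_ isT yu uz).
  have : W <= 2 * q * h ^+ 2 by apply: Hh; lra.
  lra.
Qed.

Lemma chord_gap (R : realType) (f : R -> R) (h W : R) :
  0 < h -> {within `[0, 1], continuous f} ->
  (forall t s : R, 0 <= s <= h -> 0 <= t - s -> t + s <= 1 ->
    `|f (t + s) - 2 * f t + f (t - s)| <= W) ->
  forall y z q t : R, 0 <= y -> y < z -> z <= 1 -> 0 <= q ->
  (2 * h <= z - y -> W <= 2 * q * h ^+ 2) ->
  y <= t <= z ->
  `|f t - ((z - t) * f y + (t - y) * f z) / (z - y)|
    <= q * ((t - y) * (z - t)) + W.
Proof.
move=> h0 cf HW y z q t y0 yz z1 q0 Hh tyz.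
have cfyz : {within `[y, z], continuous f}.
  by apply: continuous_subspaceW cf => u /=; rewrite !in_itv /=; lra.
have HWyz u s : 0 <= s <= h -> y <= u - s -> u + s <= z ->
    - W <= f (u + s) - 2 * f u + f (u - s) <= W.
  by move=> sh yu uz; rewrite -ler_norml; apply: HW => //; lra.
have cNf : {within `[y, z], continuous (\- f)}.
  by move=> u; apply: cvgN; exact: cfyz.
have := @chord_gap_le R f y z h q W t yz h0 q0 cfyz _ Hh tyz.
have := @chord_gap_le R (\- f) y z h q W t yz h0 q0 cNf _ Hh tyz.
have -> : ((z - t) * (\- f) y + (t - y) * (\- f) z) / (z - y) =
   - (((z - t) * f y + (t - y) * f z) / (z - y)) by rewrite /=; ring.
set c := _ / (z - y); set e := q * _ => lower upper.
have {}lower : - f t <= - c + e + W.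
  by apply: lower => u s sh yu uz; have := HWyz u s sh yu uz; rewrite /=; lra.
have {}upper : f t <= c + e + W.
  by apply: upper => u s sh yu uz; have := HWyz u s sh yu uz; lra.
by rewrite ler_norml; apply/andP; split; lra.
Qed.

(** * Affine majorants with controlled slope *)

(** Full steps of length h cost W1 each. The remaining fraction of a step is compared with a chord
    of length h, so it costs that fraction of W1, plus a single W2. *)
Lemma increment_le (R : realType) (f : R -> R) (h W1 W2 : R) :
  0 < h <= 1 / 2 -> {within `[0, 1], continuous f} ->
  (forall u v : R, 0 <= u <= 1 -> 0 <= v <= 1 -> `|u - v| <= h ->
    `|f u - f v| <= W1) ->
  (forall t s : R, 0 <= s <= h -> 0 <= t - s -> t + s <= 1 ->
    `|f (t + s) - 2 * f t + f (t - s)| <= W2) ->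
  forall x z : R, 0 <= x -> x <= z -> z <= 1 ->
  f z - f x <= W1 / h * (z - x) + W2.
Proof.
move=> /andP[h0 h12] cf HW1 HW2 x z x0 xz z1.
have h0' : h != 0 by rewrite gt_eqF.
have hh v : v + h - v = h by ring.
have step v : 0 <= v -> v + h <= 1 -> f (v + h) - f v <= W1.
  move=> v0 v1; apply: le_trans (ler_norm _) _.
  by apply: HW1; rewrite ?hh ?(gtr0_norm h0) //; apply/andP; split; lra.
have step_frac v (d : R) : 0 <= d -> 0 <= v -> v + h <= 1 ->
    d / h * (f (v + h) - f v) <= W1 / h * d.
  move=> d0 v0 v1; have -> : W1 / h * d = d / h * W1 by ring.
  by apply: ler_wpM2l; [rewrite divr_ge0 // ltW | exact: step].
have gap v t : 0 <= v -> v + h <= 1 -> v <= t <= v + h ->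
    `|f t - (f v + (t - v) / h * (f (v + h) - f v))| <= W2.
  move=> v0 v1 tv.
  (* The interval has length h < 2h, hence q = 0 is admissible. *)
  have := @chord_gap R f h W2 h0 cf HW2 v (v + h) 0 t v0 _ v1 (lexx _) _ tv.
  rewrite mul0r add0r hh.
  have -> : ((v + h - t) * f v + (t - v) * f (v + h)) / h =
     f v + (t - v) / h * (f (v + h) - f v) by field.
  by apply; lra.
have [m] : exists m : nat, z - x < m.+1%:R * h.
  by exists (Num.truncn ((z - x) / h)); rewrite -ltr_pdivrMr //; exact: truncnS_gt.
elim: m x x0 xz => [|m IHm] x x0 xz.
  rewrite mul1r => zxh.
  have [xh|xh] := leP (x + h) 1.
    have := gap x z x0 xh; rewrite ler_norml => /(_ _)/andP A.
    have [|_ A2] := A; first by apply/andP; split; lra.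
    have := @step_frac x (z - x); lra.
  (* The chord over [x, x + h] would leave [0, 1], so the one over [z - h, z] replaces it; z - h >=
     0 because z >= x > 1 - h >= h. *)
  have zhh : z - h + h = z by ring.
  have := gap (z - h) x; have := @step_frac (z - h) (z - x).
  rewrite zhh ler_norml => B A.
  have {}B : (z - x) / h * (f z - f (z - h)) <= W1 / h * (z - x) by apply: B; lra.
  have {A}/andP[A _] : - W2 <=
      f x - (f (z - h) + (x - (z - h)) / h * (f z - f (z - h))) <= W2.
    by apply: A => //; [lra|apply/andP; split; lra].
  have E : (x - (z - h)) / h * (f z - f (z - h)) =
     f z - f (z - h) - (z - x) / h * (f z - f (z - h)) by field.
  lra.
move=> zxm; have [zxh|zxh] := leP h (z - x); last first.
  apply: IHm => //; apply: lt_le_trans zxh _.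
  by rewrite ler_peMl ?(ltW h0) // ler1n.
have := IHm (x + h); have := step x x0.
have -> : W1 / h * (z - (x + h)) = W1 / h * (z - x) - W1 by field.
move=> A B; have {}A : f (x + h) - f x <= W1 by apply: A; lra.
have : f z - f (x + h) <= W1 / h * (z - x) - W1 + W2.
  by apply: B; [lra|lra|move: zxm; rewrite -[m.+2%:R]natr1; lra].
lra.
Qed.

(* The slope exists by one-dimensional Hahn-Banach separation: chord_gap puts
   the required lower bounds (from points right of x) below the upper ones
   (from points left of x), and increment_le keeps it within [-W1/h, W1/h]. *)
Lemma affine_majorant (R : realType) (f : R -> R) (h W1 W2 : R) :
  0 < h <= 1 / 2 -> {within `[0, 1], continuous f} ->
  (forall u v : R, 0 <= u <= 1 -> 0 <= v <= 1 -> `|u - v| <= h ->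
    `|f u - f v| <= W1) ->
  (forall t s : R, 0 <= s <= h -> 0 <= t - s -> t + s <= 1 ->
    `|f (t + s) - 2 * f t + f (t - s)| <= W2) ->
  forall x : R, 0 <= x <= 1 ->
  exists2 s : R, `|s| <= W1 / h & forall t : R, 0 <= t <= 1 ->
    f t - f x <= s * (t - x) + (1 + (t - x) ^+ 2 / (2 * h ^+ 2)) * W2.
Proof.
move=> hh cf HW1 HW2 x /andP[x0 x1]; have /andP[h0 h12] := hh.
have h0' : h != 0 by rewrite gt_eqF.
have W10 : 0 <= W1.
  apply: le_trans (HW1 x x _ _ _); rewrite ?x0 ?x1 ?subrr ?normr0 //.
  exact: ltW.
have W20 : 0 <= W2.
  by apply: le_trans (HW2 x 0 _ _ _); rewrite ?lexx ?(ltW h0) ?subr0 ?addr0.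
have W1h : 0 <= W1 / h by rewrite divr_ge0 // ltW.
have h2_ge0 : 0 <= 2 * h ^+ 2 by rewrite mulr_ge0 ?sqr_ge0.
pose Q (u : R) := (1 + u ^+ 2 / (2 * h ^+ 2)) * W2.
have QW u : W2 <= Q u.
  by rewrite /Q mulrDl mul1r lerDl mulr_ge0 // divr_ge0 ?sqr_ge0 ?h2_ge0.
(* The element [- (W1 / h)] bounds the supremum from below and keeps the set nonempty when x = 1. *)
pose slopes := [set - (W1 / h)] `|`
  [set s | exists z : R,
    [/\ x < z, z <= 1 & s = (f z - f x - Q (z - x)) / (z - x)]].
have slopes0 : slopes !=set0 by exists (- (W1 / h)); left.
have ub_right : ubound slopes (W1 / h).
  move=> s [->|[z [xz z1 ->]]]; first by lra.
  rewrite ler_pdivrMr ?subr_gt0 //.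
  have := @increment_le R f h W1 W2 hh cf HW1 HW2 x z x0 (ltW xz) z1.
  have := QW (z - x); lra.
have hs : has_sup slopes by split => //; exists (W1 / h).
pose s := sup slopes.
exists s.
  rewrite ler_norml; apply/andP; split; last exact: ge_sup.
  by apply: ub_le_sup; [exact: hs.2 | left].
move=> t /andP[t0 t1]; rewrite -/(Q (t - x)).
have [tx|xt|->] := ltgtP t x; last first.
- by rewrite !subrr mulr0 add0r; apply: le_trans (QW _).
- have : (f t - f x - Q (t - x)) / (t - x) <= s.
    by apply: ub_le_sup; [exact: hs.2 | right; exists t].
  by rewrite ler_pdivrMr ?subr_gt0 //; lra.
suff : s <= (f x - f t + Q (t - x)) / (x - t).
  by rewrite ler_pdivlMr ?subr_gt0 //; lra.
apply: ge_sup => // r [->|[z [xz z1 ->]]].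
  rewrite ler_pdivlMr ?subr_gt0 //.
  have := @increment_le R (\- f) h W1 W2 hh _ _ _ t x t0 (ltW tx) x1.
  move=> /= A; have : - f x - - f t <= W1 / h * (x - t) + W2.
    apply: A.
    - by move=> u; apply: cvgN; exact: cf.
    - by move=> u v u01 v01 uv; rewrite -opprD normrN; exact: HW1.
    - move=> u v v01 u1 u2.
      have -> : - f (u + v) - 2 * - f u + - f (u - v) =
        - (f (u + v) - 2 * f u + f (u - v)) by ring.
      by rewrite normrN; exact: HW2.
  have := QW (t - x); lra.
rewrite ler_pdivlMr ?subr_gt0 // mulrAC ler_pdivrMr ?subr_gt0 //.
have tz : t < z by exact: lt_trans xz.
(* With denominators cleared, the comparison of the slopes from t and from z is [chord_gap] on
   [t, z] at the point x. This q turns the condition [W2 <= 2 * q * h ^+ 2] into an equality. *)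
have q0 : 0 <= W2 / (2 * h ^+ 2) by rewrite divr_ge0 // mulr_ge0 ?sqr_ge0.
have := @chord_gap R f h W2 h0 cf HW2 t z (W2 / (2 * h ^+ 2)) x t0 tz z1 q0.
have -> : 2 * (W2 / (2 * h ^+ 2)) * h ^+ 2 = W2 by field.
move=> /(_ (fun=> lexx _)); rewrite (ltW tx) (ltW xz) => /(_ isT).
rewrite ler_norml => /andP[A _].
set C := (X in f x - X) in A.
have {}A : (C - f x) * (z - t) <=
    (W2 / (2 * h ^+ 2) * ((x - t) * (z - x)) + W2) * (z - t).
  by rewrite ler_pM2r ?subr_gt0 //; lra.
have CE : C * (z - t) = (z - x) * f t + (x - t) * f z.
  by rewrite /C divfK // subr_eq0 gt_eqF.
(* The two-point law on {t, z} with mean x has variance (x - t) (z - x). *)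
have QE : (z - x) * Q (t - x) + (x - t) * Q (z - x) =
   (W2 / (2 * h ^+ 2) * ((x - t) * (z - x)) + W2) * (z - t).
  by rewrite /Q; field.
lra.
Qed.

(** * Paltanea's estimate for finite weighted sums *)

Lemma paltanea_le (R : realType) (f : R -> R) (h W1 W2 : R) (I : finType)
    (w t : I -> R) (x : R) :
  0 < h <= 1 / 2 -> {within `[0, 1], continuous f} ->
  (forall u v : R, 0 <= u <= 1 -> 0 <= v <= 1 -> `|u - v| <= h ->
    `|f u - f v| <= W1) ->
  (forall t s : R, 0 <= s <= h -> 0 <= t - s -> t + s <= 1 ->
    `|f (t + s) - 2 * f t + f (t - s)| <= W2) ->
  0 <= x <= 1 -> (forall i, 0 <= w i) -> \sum_i w i = 1 ->
  (forall i, 0 <= t i <= 1) ->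
  \sum_i f (t i) * w i - f x <=
    `|\sum_i (t i - x) * w i| / h * W1
    + (1 + (\sum_i (t i - x) ^+ 2 * w i) / (2 * h ^+ 2)) * W2.
Proof.
move=> hh cf HW1 HW2 x01 w0 w1 t01.
have [s sW Hs] := affine_majorant _ _ _ _ _ hh cf HW1 HW2 x x01.
have {1}-> : f x = \sum_i f x * w i by rewrite -mulr_sumr w1 mulr1.
rewrite -sumrB.
apply: (@le_trans _ _ (\sum_i (s * ((t i - x) * w i) + (W2 * w i
    + W2 / (2 * h ^+ 2) * ((t i - x) ^+ 2 * w i))))).
  apply: ler_sum => i _; rewrite -mulrBl.
  have -> : s * ((t i - x) * w i) + (W2 * w i +
     W2 / (2 * h ^+ 2) * ((t i - x) ^+ 2 * w i)) =
     (s * (t i - x) + (1 + (t i - x) ^+ 2 / (2 * h ^+ 2)) * W2) * w i by ring.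
  by apply: ler_wpM2r => //; exact: Hs.
rewrite !big_split /= -!mulr_sumr w1 mulr1.
apply: lerD; last first.
  by rewrite le_eqVlt; apply/orP; left; apply/eqP; ring.
apply: le_trans (ler_norm _) _; rewrite normrM mulrC -mulrA; apply: ler_wpM2l => //.
by rewrite mulrC.
Qed.

Lemma paltanea (R : realType) (f : R -> R) (h : R) (I : finType)
    (w t : I -> R) (x : R) :
  0 < h <= 1 / 2 -> {within `[0, 1], continuous f} ->
  0 <= x <= 1 -> (forall i, 0 <= w i) -> \sum_i w i = 1 ->
  (forall i, 0 <= t i <= 1) ->
  [/\ 0 <= omega1 f h, 0 <= omega2 f h &
  `|\sum_i f (t i) * w i - f x| <=
    `|\sum_i (t i - x) * w i| / h * omega1 f h
    + (1 + (\sum_i (t i - x) ^+ 2 * w i) / (2 * h ^+ 2)) * omega2 f h].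
Proof.
move=> hh cf x01 w0 w1 t01.
have /andP[h0 _] := hh.
(* A [sup] dominates the elements of its set only if that set is bounded above; M ensures this for
   both moduli. *)
have [M HM] : exists M, forall u : R, 0 <= u <= 1 -> `|f u| <= M.
  have [c _ cmax] := EVT_max ler01 cf.
  have [d _ dmin] := EVT_min ler01 cf.
  exists (`|f c| + `|f d|) => u u01.
  have := cmax u; have := dmin u; rewrite !in_itv /= => /(_ u01) A /(_ u01) B.
  have := ler_norm (f c); have := lerNnormlW (lexx `|f d|).
  have := normr_ge0 (f c); have := normr_ge0 (f d).
  by move=> *; rewrite ler_norml; apply/andP; split; lra.
have HW1 (u v : R) : 0 <= u <= 1 -> 0 <= v <= 1 -> `|u - v| <= h ->
    `|f u - f v| <= omega1 f h.
  move=> u01 v01 uv; apply: ub_le_sup; last by exists u, v.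
  exists (M + M) => _ [a [b [a01 b01 _ ->]]].
  by apply: le_trans (ler_normB _ _) _; apply: lerD; exact: HM.
have HW2 (u s : R) : 0 <= s <= h -> 0 <= u - s -> u + s <= 1 ->
    `|f (u + s) - 2 * f u + f (u - s)| <= omega2 f h.
  move=> sh us us1; apply: ub_le_sup; last first.
    by exists u, s; split => //; apply/andP; split; lra.
  exists (M + 2 * M + M) => _ [a [b [b0 ab1 ab2 ->]]].
  apply: le_trans (ler_normD _ _) _; apply: lerD; last exact: HM.
  apply: le_trans (ler_normB _ _) _; apply: lerD; first exact: HM.
  by rewrite normrM ger0_norm // ler_pM2l //; apply: HM; apply/andP; split; lra.
split.
- by apply: le_trans (HW1 x x x01 x01 _); rewrite ?subrr ?normr0 ?(ltW h0).
- have /andP[x0 x1] := x01.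
  by apply: le_trans (HW2 x 0 _ _ _); rewrite ?lexx ?(ltW h0) ?subr0 ?addr0.
have cNf : {within `[0, 1], continuous (\- f)}.
  by move=> u; apply: cvgN; exact: cf.
have U := @paltanea_le R f h _ _ I w t x hh cf HW1 HW2 x01 w0 w1 t01.
rewrite ler_norml; apply/andP; split; last exact: U.
rewrite lerNl opprB addrC.
have -> : - (\sum_i f (t i) * w i) + f x = \sum_i (\- f) (t i) * w i - (\- f) x.
  rewrite /= opprK; congr (_ + _); rewrite -sumrN.
  by apply: eq_bigr => i _; rewrite mulNr.
apply: paltanea_le => //.
- by move=> u v u01 v01 uv; rewrite /= -opprD normrN; exact: HW1.
- move=> u v v01 u1 u2 /=.
  have -> : - f (u + v) - 2 * - f u + - f (u - v) =
    - (f (u + v) - 2 * f u + f (u - v)) by ring.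
  by rewrite normrN; exact: HW2.
Qed.

(** * Moments of the Bernstein basis *)

(** Each induction step absorbs one factor by k C(n, k) = n C(n - 1, k - 1). Falling factorials are
    the natural moments here, since the j-th powers of the nodes are proportional to them. *)
Lemma bernstein_factorial_moment (R : realType) (n j : nat) (x : R) :
  \sum_(k < n.+1) (k ^_ j)%:R * bernstein_basis n k x = (n ^_ j)%:R * x ^+ j.
Proof.
elim: j n => [|j IHj] n.
  transitivity ((1 - x + x) ^+ n); last first.
    by rewrite subrK expr1n ffactn0 expr0 mulr1.
  rewrite exprDn; apply: eq_bigr => k _.
  by rewrite ffactn0 mul1r /bernstein_basis -[RHS]mulr_natl -mulrA [x ^+ k * _]mulrC.
case: n => [|n].
  by rewrite big_ord1 mul0r ffact0n mul0r.
rewrite big_ord_recl ffact0n mul0r add0r ffactSS natrM exprS mulrACA -mulrA.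
rewrite -[in RHS]IHj mulrA mulr_sumr; apply: eq_bigr => k _.
rewrite /bernstein_basis lift0 ffactSS subSS exprS.
have := mul_bin_diag n.+1 k; move=> /(congr1 (fun m : nat => m%:R : R)).
rewrite /= !natrM => E.
transitivity ((k.+1%:R * 'C(n.+1, k.+1)%:R) *
  ((k ^_ j)%:R * (x * x ^+ k * (1 - x) ^+ (n - k)))); first by ring.
by rewrite -E; ring.
Qed.

Lemma bernstein_basis_ge0 (R : realType) (n k : nat) (x : R) :
  0 <= x <= 1 -> 0 <= bernstein_basis n k x.
Proof.
by move=> /andP[x0 x1]; rewrite !mulr_ge0 ?exprn_ge0 ?subr_ge0.
Qed.

Lemma sum_bernstein_basis (R : realType) (n : nat) (x : R) :
  \sum_(k < n.+1) bernstein_basis n k x = 1.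
Proof.
have := bernstein_factorial_moment R n 0 x.
rewrite expr0 mulr1 => E; apply: etrans E.
by apply: eq_bigr => k _; rewrite ffactn0 mul1r.
Qed.

Lemma bernstein_mean (R : realType) (n : nat) (x : R) : (0 < n)%N ->
  \sum_(k < n.+1) k%:R / n%:R * bernstein_basis n k x = x.
Proof.
move=> n0; have n0' : n%:R != 0 :> R by rewrite pnatr_eq0 -lt0n.
apply: (mulfI n0'); rewrite mulr_sumr.
have := bernstein_factorial_moment R n 1 x; rewrite ffactn1 expr1 => <-.
by apply: eq_bigr => k _; rewrite ffactn1; field.
Qed.

Lemma natr_ffact2 (R : realType) (n : nat) :
  (n ^_ 2)%:R = n%:R * (n%:R - 1) :> R.
Proof.
case: n => [|n]; first by rewrite ffact0n mul0r.
by rewrite ffactSS ffactn1 natrM -natr1 addrK.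
Qed.

Lemma bernstein_variance (R : realType) (n : nat) (x : R) : (0 < n)%N ->
  \sum_(k < n.+1) (k%:R / n%:R - x) ^+ 2 * bernstein_basis n k x
  = x * (1 - x) / n%:R.
Proof.
move=> n0; have n0' : n%:R != 0 :> R by rewrite pnatr_eq0 -lt0n.
transitivity (\sum_(k < n.+1) (
  (n%:R ^+ 2)^-1 * ((k ^_ 2)%:R * bernstein_basis n k x)
  + (n%:R^-1 - 2 * x) * (k%:R / n%:R * bernstein_basis n k x)
  + x ^+ 2 * bernstein_basis n k x)).
  by apply: eq_bigr => k _; rewrite natr_ffact2; field.
rewrite !big_split /= -!mulr_sumr bernstein_factorial_moment bernstein_mean //.
by rewrite sum_bernstein_basis natr_ffact2; field.
Qed.

(** * Bounds on the nodes *)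

Lemma ffact_le_expn (n m : nat) : (n ^_ m <= n ^ m)%N.
Proof.
by elim: m => // m IHm; rewrite ffactnSr expnSr leq_mul ?leq_subr.
Qed.

Lemma expn_subn_le_ffact (k j : nat) : ((k - j.-1) ^ j <= k ^_ j)%N.
Proof.
(* The base stays fixed while the exponent grows: each factor k - i with i < j is at least
   [k - j.-1]. *)
suff : forall i, (i <= j)%N -> ((k - j.-1) ^ i <= k ^_ i)%N by exact.
elim=> // i IHi ij; rewrite expnSr ffactnSr leq_mul ?IHi ?(ltnW ij) //.
by rewrite leq_sub2l // -ltnS (ltn_predK ij).
Qed.

(** Factor by factor, (k - i) n <= (n - i) k because k <= n. *)
Lemma ffact_expn_le (n k j : nat) : (k <= n)%N ->
  (k ^_ j * n ^ j <= n ^_ j * k ^ j)%N.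
Proof.
move=> kn; elim: j => // j IHj; rewrite !ffactnSr !expnSr.
rewrite mulnACA [leqRHS]mulnACA leq_mul // !mulnBl [(n * k)%N]mulnC.
by rewrite leq_sub2l // leq_mul2l kn orbT.
Qed.

Lemma akr_node_ge0 (R : realType) (n j k : nat) : 0 <= akr_node R n j k.
Proof. exact: powR_ge0. Qed.

Lemma akr_nodeX (R : realType) (n j k : nat) : (0 < j)%N ->
  akr_node R n j k ^+ j = (k ^_ j)%:R / (n ^_ j)%:R.
Proof.
move=> j0; rewrite -powR_mulrn ?akr_node_ge0 // -powRrM mulVf ?pnatr_eq0 -?lt0n //.
by rewrite powRr1 // divr_ge0.
Qed.

Lemma akr_node_le (R : realType) (n j k : nat) :
  (0 < j)%N -> (j <= n)%N -> (k <= n)%N -> akr_node R n j k <= k%:R / n%:R.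
Proof.
move=> j0 jn kn; have n0 : (0 < n)%N by exact: leq_trans jn.
rewrite -(@ler_pXn2r _ j) ?nnegrE ?akr_node_ge0 ?divr_ge0 // akr_nodeX //.
rewrite ler_pdivrMr ?ltr0n ?ffact_gt0 // expr_div_n mulrAC.
rewrite ler_pdivlMr ?exprn_gt0 ?ltr0n // -!natrX -!natrM ler_nat.
by rewrite [leqRHS]mulnC ffact_expn_le.
Qed.

Lemma akr_node_ge (R : realType) (n j k : nat) :
  (0 < j)%N -> (j <= n)%N ->
  (k%:R - (j%:R - 1)) / n%:R <= akr_node R n j k.
Proof.
move=> j0 jn; have n0 : (0 < n)%N by exact: leq_trans jn.
(* Truncated subtraction gives a nonnegative intermediate bound, so j-th powers can be compared. *)
apply: (@le_trans _ _ ((k - j.-1)%:R / n%:R)).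
  rewrite ler_pM2r ?invr_gt0 ?ltr0n // lerBlDr.
  have -> : j%:R - 1 = j.-1%:R :> R by rewrite -[in LHS](prednK j0) -natr1 addrK.
  by rewrite -natrD ler_nat addnC -leq_subLR.
rewrite -(@ler_pXn2r _ j) ?nnegrE ?akr_node_ge0 ?divr_ge0 // akr_nodeX //.
rewrite expr_div_n -!natrX ler_pM ?invr_ge0 // ?ler_nat ?expn_subn_le_ffact //.
by rewrite lef_pV2 ?posrE ?ltr0n ?expn_gt0 ?n0 ?ffact_gt0 // ler_nat ffact_le_expn.
Qed.

Lemma akr_node2_ge (R : realType) (n k : nat) :
  (2 <= n)%N -> (0 < k)%N -> (k <= n)%N ->
  k%:R / n%:R - akr_node R n 2 k <= (1 - k%:R / n%:R) / (n%:R - 1).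
Proof.
move=> n2 k0 kn.
have n0 : 0 < n%:R :> R by rewrite ltr0n (leq_trans _ n2).
have n1 : 0 < n%:R - 1 :> R by rewrite subr_gt0 ltr1n.
have tX := @akr_nodeX R n 2 k isT; have t_le := @akr_node_le R n 2 k isT n2 kn.
have t0 := akr_node_ge0 R n 2 k.
move: (akr_node R n 2 k) tX t_le t0 => t tX t_le t0.
have a0 : 0 < k%:R / n%:R :> R by rewrite divr_gt0 // ltr0n.
have E : (k%:R / n%:R - t) * (k%:R / n%:R + t)
    = k%:R / n%:R * ((1 - k%:R / n%:R) / (n%:R - 1)).
  rewrite mulrDr [LHS](_ : _ = (k%:R / n%:R) ^+ 2 - t ^+ 2); last by ring.
  by rewrite tX !natr_ffact2; field; rewrite !gt_eqF.
(* After multiplication by k/n, the right side is (k/n - t)(k/n + t), and k/n <= k/n + t. *)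
rewrite -(ler_pM2l a0) -E mulrC; apply: ler_wpM2l; first by rewrite subr_ge0.
by rewrite lerDl.
Qed.

(** * First and second moments of the operators *)

Lemma akr_operator_paltanea (R : realType) (f : R -> R) (x h : R) (j n : nat) :
  {within `[0, 1], continuous f} -> 0 <= x <= 1 -> (1 <= j <= n)%N ->
  0 < h <= 1 / 2 ->
  [/\ 0 <= omega1 f h, 0 <= omega2 f h &
  `|akr_operator n j f x - f x| <=
    `|\sum_(k < n.+1) (akr_node R n j k - x) * bernstein_basis n k x| / h
      * omega1 f h
    + (1 + (\sum_(k < n.+1) (akr_node R n j k - x) ^+ 2
              * bernstein_basis n k x) / (2 * h ^+ 2)) * omega2 f h].
Proof.
move=> cf x01 /andP[j0 jn] hh; rewrite /akr_operator big_mkord.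
apply: (@paltanea R f h 'I_n.+1 (fun k => bernstein_basis n k x)
  (fun k => akr_node R n j k)) => //.
- by move=> k; exact: bernstein_basis_ge0.
- exact: sum_bernstein_basis.
- move=> k; have kn : (k <= n)%N by rewrite -ltnS.
  rewrite akr_node_ge0 /=; apply: le_trans (akr_node_le R n j k j0 jn kn) _.
  by rewrite ler_pdivrMr ?ltr0n ?(leq_trans j0) // mul1r ler_nat.
Qed.

Lemma akr_first_moment (R : realType) (j n : nat) (x : R) : (0 < n)%N ->
  \sum_(k < n.+1) (akr_node R n j k - x) * bernstein_basis n k x =
  - \sum_(k < n.+1) (k%:R / n%:R - akr_node R n j k) * bernstein_basis n k x.
Proof.
move=> n0; under eq_bigr do rewrite mulrBl.
under [in RHS]eq_bigr do rewrite mulrBl.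
by rewrite !sumrB bernstein_mean // -mulr_sumr sum_bernstein_basis mulr1 opprB.
Qed.

Lemma akr_deficit_ge0 (R : realType) (j n : nat) (x : R) :
  0 <= x <= 1 -> (1 <= j <= n)%N ->
  0 <= \sum_(k < n.+1) (k%:R / n%:R - akr_node R n j k) * bernstein_basis n k x.
Proof.
move=> x01 /andP[j0 jn]; apply: sumr_ge0 => k _.
by rewrite mulr_ge0 ?bernstein_basis_ge0 // subr_ge0 akr_node_le // -ltnS.
Qed.

Lemma akr_deficit_le (R : realType) (j n : nat) (x : R) :
  0 <= x <= 1 -> (1 <= j <= n)%N ->
  \sum_(k < n.+1) (k%:R / n%:R - akr_node R n j k) * bernstein_basis n k x
    <= (j%:R - 1) / n%:R.
Proof.
move=> x01 /andP[j0 jn].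
apply: (@le_trans _ _
  (\sum_(k < n.+1) (j%:R - 1) / n%:R * bernstein_basis n k x)).
  apply: ler_sum => k _; apply: ler_wpM2r; first exact: bernstein_basis_ge0.
  by have := akr_node_ge R n j k j0 jn; rewrite mulrBl; lra.
by rewrite -mulr_sumr sum_bernstein_basis mulr1.
Qed.

(** The sum of (1 - k/n) p_k is 1 - x, and removing its term k = 0, which is (1 - x)^n, leaves
    [dn n x]. That term can be removed because the node at k = 0 is 0 and has no deficit. *)
Lemma akr2_deficit_le (R : realType) (n : nat) (x : R) :
  0 <= x <= 1 -> (2 <= n)%N ->
  \sum_(k < n.+1) (k%:R / n%:R - akr_node R n 2 k) * bernstein_basis n k x
    <= dn n x / (n%:R - 1).
Proof.
move=> x01 n2; have n0 : (0 < n)%N by exact: ltnW.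
have dnE : dn n x =
   \sum_(k < n.+1) (1 - k%:R / n%:R) * bernstein_basis n k x
   - bernstein_basis n 0 x.
  under eq_bigr do rewrite mulrBl mul1r.
  rewrite sumrB sum_bernstein_basis bernstein_mean // /dn /bernstein_basis.
  rewrite bin0 expr0 !mul1r subn0 -[in (1 - x) ^+ n](subnK n0) exprD expr1.
  by ring.
rewrite dnE !big_ord_recl /= mul0r subr0 mul1r [X in _ <= X / _]addrAC subrr !add0r.
rewrite mulr_suml {1}/akr_node ffact0n mul0r powR0 ?invr_eq0 ?pnatr_eq0 //.
rewrite oppr0 mul0r add0r; apply: ler_sum => k _.
rewrite mulrAC; apply: ler_wpM2r; first exact: bernstein_basis_ge0.
by apply: akr_node2_ge.
Qed.

(** For j = 2 the operator reproduces x^2, so the second moment is 2x(x - m), where m is the mean of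
    the nodes. *)
Lemma akr2_second_moment (R : realType) (n : nat) (x : R) : (2 <= n)%N ->
  \sum_(k < n.+1) (akr_node R n 2 k - x) ^+ 2 * bernstein_basis n k x =
  2 * x *
    \sum_(k < n.+1) (k%:R / n%:R - akr_node R n 2 k) * bernstein_basis n k x.
Proof.
move=> n2; have n0 : (0 < n)%N by exact: ltnW.
have n1 : (n ^_ 2)%:R != 0 :> R by rewrite pnatr_eq0 -lt0n ffact_gt0.
rewrite -[X in 2 * x * X]opprK -akr_first_moment //.
transitivity (\sum_(k < n.+1) (
   (n ^_ 2)%:R^-1 * ((k ^_ 2)%:R * bernstein_basis n k x)
   - 2 * x * ((akr_node R n 2 k - x) * bernstein_basis n k x)
   - x ^+ 2 * bernstein_basis n k x)).
  apply: eq_bigr => k _; have E := @akr_nodeX R n 2 k isT.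
  transitivity ((akr_node R n 2 k ^+ 2 - 2 * x * (akr_node R n 2 k - x) - x ^+ 2)
     * bernstein_basis n k x); first by ring.
  by rewrite E; ring.
rewrite !sumrB -!mulr_sumr bernstein_factorial_moment sum_bernstein_basis.
by rewrite mulrA mulVf //; ring.
Qed.

(** Since 0 <= t <= k/n, termwise (t - x)^2 <= (k/n - x)^2 + 2x(k/n - t). The Bernstein variance
    gives 1/4 through x(1 - x) <= 1/4, and the deficit gives 2(j - 1). *)
Lemma akr_second_moment_le (R : realType) (j n : nat) (x : R) :
  0 <= x <= 1 -> (1 <= j <= n)%N ->
  \sum_(k < n.+1) (akr_node R n j k - x) ^+ 2 * bernstein_basis n k x <=
  (1 / 4 + 2 * (j%:R - 1)) / n%:R.
Proof.
move=> x01 jn'; have /andP[j0 jn] := jn'.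
have n0 : (0 < n)%N by exact: leq_trans jn.
have /andP[x0 x1] := x01.
apply: (@le_trans _ _ (\sum_(k < n.+1) (
  (k%:R / n%:R - x) ^+ 2 * bernstein_basis n k x
  + 2 * x * ((k%:R / n%:R - akr_node R n j k) * bernstein_basis n k x)))).
  apply: ler_sum => k _; rewrite [2 * x * _]mulrA -mulrDl.
  apply: ler_wpM2r; first exact: bernstein_basis_ge0.
  have := akr_node_le R n j k j0 jn; rewrite -ltnS ltn_ord => /(_ isT) t_le.
  have : akr_node R n j k ^+ 2 <= (k%:R / n%:R) ^+ 2.
    by rewrite ler_pXn2r ?nnegrE ?akr_node_ge0 ?divr_ge0.
  lra.
rewrite big_split /= -mulr_sumr bernstein_variance // [leRHS]mulrDl lerD //.
  rewrite ler_pM2r ?invr_gt0 ?ltr0n //.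
  by have := sqr_ge0 (x - 1 / 2); lra.
have := akr_deficit_le R j n x x01 jn'; have := akr_deficit_ge0 R j n x x01 jn'.
set D := \sum_(_ < _) _ => D0 D1.
by rewrite -!mulrA ler_pM2l //; apply: le_trans D1; rewrite ler_piMl.
Qed.

Theorem proposition2p2 (R : realType) (f : R -> R) (x : R) (j n : nat)
    (hf : {within `[0, 1], continuous f}) (hx : 0 <= x <= 1)
    (hj : (1 <= j)%N) (hjn : (j <= n)%N) :
  ((5 <= n)%N ->
    `|akr_operator n 2 f x - f x| <=
      1 / Num.sqrt (n%:R - 1) * dn n x * omega1 f (1 / Num.sqrt (n%:R - 1))
      + (1 + x * dn n x) * omega2 f (1 / Num.sqrt (n%:R - 1)))
  /\
  ((4 <= n)%N ->
    `|akr_operator n j f x - f x| <=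
      (j%:R - 1) * (1 / Num.sqrt n%:R) * omega1 f (1 / Num.sqrt n%:R)
      + (1 / 8 + j%:R) * omega2 f (1 / Num.sqrt n%:R)).
Proof.
(* The thresholds n >= 5 and n >= 4 both say that the step h is at most 1/2. *)
have stepP (r : R) : 4 <= r -> 0 < 1 / Num.sqrt r <= 1 / 2.
  move=> r4; have s2 : 2 <= Num.sqrt r.
    by rewrite -(@ler_pXn2r _ 2) ?nnegrE // sqr_sqrtr; lra.
  have s0 : 0 < Num.sqrt r by exact: lt_le_trans s2.
  by rewrite divr_gt0 //= !div1r lef_pV2 ?posrE.
have stepX (r : R) : 4 <= r -> (1 / Num.sqrt r) ^+ 2 = r^-1.
  by move=> r4; rewrite div1r exprVn sqr_sqrtr //; lra.
split=> [n5|n4].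
- have r4 : 4 <= n%:R - 1 :> R.
    by have : 5%:R <= n%:R :> R; [rewrite ler_nat | lra].
  have n2 : (2 <= n)%N by exact: leq_trans n5.
  have := stepP _ r4; have := stepX _ r4.
  set h := 1 / Num.sqrt (n%:R - 1) => hX hh; have /andP[h0 _] := hh.
  have [w1 w2 B] := akr_operator_paltanea R f x h 2 n hf hx n2 hh.
  apply: le_trans B _.
  rewrite akr2_second_moment // akr_first_moment ?(ltnW n2) // normrN.
  rewrite ger0_norm ?akr_deficit_ge0 //.
  have := akr2_deficit_le R n x hx n2.
  set D := \sum_(_ < _) _; rewrite ler_pdivlMr; last by lra.
  move=> DE; apply: lerD; apply: ler_wpM2r => //.
    rewrite ler_pdivrMr // mulrAC -expr2 hX mulrC ler_pdivlMr //; lra.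
  rewrite hX lerD2l; have /andP[x0 _] := hx.
  have -> : 2 * x * D / (2 / (n%:R - 1)) = x * (D * (n%:R - 1)).
    by field; rewrite gt_eqF //; lra.
  exact: ler_wpM2l.
- have r4 : 4 <= n%:R :> R by rewrite ler_nat.
  have jn' : (1 <= j <= n)%N by rewrite hj.
  have := stepP _ r4; have := stepX _ r4.
  set h := 1 / Num.sqrt n%:R => hX hh; have /andP[h0 _] := hh.
  have [w1 w2 B] := akr_operator_paltanea R f x h j n hf hx jn' hh.
  apply: le_trans B _.
  have := akr_second_moment_le R j n x hx jn'.
  rewrite akr_first_moment ?(leq_trans hj) // normrN ger0_norm ?akr_deficit_ge0 //.
  have := akr_deficit_le R j n x hx jn'.
  set D := \sum_(_ < _) _; set S := \sum_(_ < _) _ => DE SE.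
  apply: lerD; apply: ler_wpM2r => //.
    by rewrite ler_pdivrMr // -mulrA -expr2 hX.
  (* The constant is 1 + (1/4 + 2(j - 1)) / 2 = 1/8 + j. *)
  move: SE; rewrite hX ler_pdivlMr; last by lra.
  have -> : S / (2 / n%:R) = S * n%:R / 2 by field; rewrite gt_eqF //; lra.
  lra.
Qed.
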